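(* Let $\Gamma=(G,\sigma)$ be a signed graph of order $n$ whose balanced clique number satisfies $\omega_{b}(\Gamma)=\omega_{b}\ge 2$. For an edge $e$ of $\Gamma$, let $c_{b}(e)$ denote the order of the largest balanced clique of $\Gamma$ containing $e$. Let $\Gamma'$ be a signed graph switching equivalent to $\Gamma$ such that $\lambda_{1}(\Gamma')$ has an eigenvector with all entries non-negative. Then $$\lambda_{1}(\Gamma)\le \sqrt{2\sum_{e\in E^{+}(\Gamma')}\frac{c_{b}(e)-1}{c_{b}(e)}}.$$ Equality holds if and only if $\Gamma$ is a balanced complete bipartite graph when $\omega_{b}=2$, or a balanced complete regular $\omega_{b}$-partite graph when $\omega_{b}\ge 3$ (in either case possibly together with some isolated vertices).
   Context: A signed graph $\Gamma=(G,\sigma)$ consists of a simple graph $G$ (the underlying graph) and a map $\sigma:E(G)\to\{+1,-1\}$. Its adjacency matrix $A(\Gamma)=(a^{\sigma}_{ij})$ has $a^{\sigma}_{ij}=\sigma(v_iv_j)$ if $v_i,v_j$ are adjacent and $0$ otherwise; $\lambda_1(\Gamma)$ denotes its largest eigenvalue. $E^{+}(\Gamma')$ is the set of positive edges (edges with sign $+1$) of $\Gamma'$. For $\theta:V\to\{+1,-1\}$, the switched signed graph $\Gamma^{\theta}$ has the same underlying graph and signs $\sigma^{\theta}(uv)=\theta(u)\sigma(uv)\theta(v)$; $\Gamma_1,\Gamma_2$ are switching equivalent if $\Gamma_2=\Gamma_1^{\theta}$ for some $\theta$. A cycle is balanced if it has an even number of negative edges; a signed graph is balanced if all its cycles are balanced.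 A balanced clique is a complete subgraph that is balanced as a signed graph, and $\omega_b(\Gamma)$ is the maximum order of a balanced clique of $\Gamma$. A ''balanced complete ($\omega_b$-partite / bipartite) graph'' means a balanced signed graph whose underlying graph is the indicated complete multipartite graph (regular meaning all parts of equal size).
   Formalization: ''Equality holds'' is read as equality for every admissible Γ', not for one fixed Γ'; for a fixed Γ' the ''only if'' fails, e.g. when Γ = Γ' is a positive edge plus a disjoint negative edge (λ1 = bound = 1, but not complete bipartite). *)

(* Defs.v *)
From HB Require Import structures.
From mathcomp Require Import all_boot all_order all_algebra.
From mathcomp Require Import boolp classical_sets reals.

Set Implicit Arguments.
Unset Strict Implicit.
Unset Printing Implicit Defensive.

Import Order.TTheory GRing.Theory Num.Theory.

Local Open Scope ring_scope.

(* The sign of an edge uv is (-1) ^+ neg u v; the value of neg on non-adjacent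
   pairs is irrelevant (see sgeq). *)
Record sgraph (n : nat) := SGraph {
  adj : rel 'I_n;
  neg : rel 'I_n;
  adj_sym : symmetric adj;
  adj_irr : irreflexive adj;
  neg_sym : symmetric neg }.

Section SignedGraphs.
Variable n : nat.
Implicit Types (G : sgraph n) (S : {set 'I_n}) (c : seq 'I_n).

Definition sgeq G1 G2 : Prop :=
  forall u v, adj G1 u v = adj G2 u v /\
              (adj G1 u v -> neg G1 u v = neg G2 u v).

Definition adjmx (R : realType) G : 'M[R]_n :=
  \matrix_(i, j) (if adj G i j then (-1) ^+ neg G i j else 0).

Definition pos_edges G : {set {set 'I_n}} :=
  [set e : {set 'I_n} |
    [exists u, exists v, [&& e == [set u; v], adj G u v & ~~ neg G u v]]].

(* theta v = true encodes the switching value -1 at v, so that the product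
   of signs becomes an exclusive or. *)
Definition switch_neg G (theta : 'I_n -> bool) : rel 'I_n :=
  fun u v => theta u (+) neg G u v (+) theta v.

Lemma switch_neg_sym G theta : symmetric (switch_neg G theta).
Proof.
move=> u v; rewrite /switch_neg (neg_sym G u v).
by case: (theta u); case: (theta v); case: (neg G v u).
Qed.

Definition switch G (theta : 'I_n -> bool) : sgraph n :=
  SGraph (adj_sym G) (adj_irr G) (switch_neg_sym G theta).

Definition switching_equivalent G1 G2 : Prop :=
  exists theta : 'I_n -> bool, sgeq G2 (switch G1 theta).

Definition is_cycle G c : bool := (2 < size c)%N && ucycleb (adj G) c.

Definition balanced_cycle G c : bool :=
  ~~ odd (count (fun v => neg G v (next c v)) c).

Definition balanced G : Prop :=
  forall c, is_cycle G c -> balanced_cycle G c.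

(* The second conjunct says that the signed subgraph induced on S is balanced:
   its cycles are the cycles of G with all their vertices in S. *)
Definition balanced_clique G S : Prop :=
  {in S &, forall u v, u != v -> adj G u v} /\
  (forall c, {subset c <= S} -> is_cycle G c -> balanced_cycle G c).

Definition omega_b G : nat :=
  \max_(S : {set 'I_n} | `[< balanced_clique G S >]) #|S|.

Definition c_b G (e : {set 'I_n}) : nat :=
  \max_(S : {set 'I_n} | `[< balanced_clique G S >] && (e \subset S)) #|S|.

(* P is the set of (nonempty) parts; vertices outside cover P are isolated. *)
Definition complete_multipartite_with G (P : {set {set 'I_n}}) : Prop :=
  finset.partition P (finset.cover P) /\
  forall u v, adj G u v =
    [&& u \in finset.cover P, v \in finset.cover P &
        finset.pblock P u != finset.pblock P v].

Definition complete_partite_plus_isolated k G : Prop :=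
  exists P : {set {set 'I_n}}, #|P| = k /\ complete_multipartite_with G P.

Definition complete_regular_partite_plus_isolated k G : Prop :=
  exists P : {set {set 'I_n}},
    [/\ #|P| = k, {in P &, forall X Y : {set 'I_n}, #|X| = #|Y|} &
        complete_multipartite_with G P].

End SignedGraphs.

(* The supremum is a maximum: the spectrum is finite (see lambda1_max), and for
   a real symmetric matrix of positive order it is nonempty. *)
Definition lambda1 (R : realType) (n : nat) (A : 'M[R]_n) : R :=
  sup [set x : R | eigenvalue A x]%classic.

Lemma lambda1_max (R : realType) (n : nat) (A : 'M[R]_n) (a : R) :
  eigenvalue A a ->
  eigenvalue A (lambda1 A) /\ (forall b, eigenvalue A b -> b <= lambda1 A).
Proof.
move=> Aa.
have [m Am leAm] : exists2 m, eigenvalue A m &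
    forall b, eigenvalue A b -> b <= m.
  apply: contrapT => nomax.
  have gtA b : eigenvalue A b -> exists2 d, eigenvalue A d & b < d.
    move=> Ab; apply: contrapT => nod; apply: nomax; exists b => // d Ad.
    by rewrite leNgt; apply/negP => ltbd; apply: nod; exists d.
  have long k : exists b rs, [/\ size rs = k, eigenvalue A b, uniq rs,
      all (root (char_poly A)) rs & all (fun z => z < b) rs].
    elim: k => [|k [b [rs [szrs Ab Urs rootrs ltrs]]]]; first by exists a, [::].
    have [d Ad ltbd] := gtA b Ab; exists d, (b :: rs); split=> //=.
    - by rewrite szrs.
    - rewrite Urs andbT; apply/negP => brs.
      by have := allP ltrs b brs; rewrite ltxx.
    - by rewrite -eigenvalue_root_char Ab.
    - by rewrite ltbd; apply: sub_all ltrs => z /lt_trans; apply.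
  have [b [rs [szrs _ Urs rootrs _]]] := long n.+1.
  have := max_poly_roots (monic_neq0 (char_poly_monic A)) rootrs Urs.
  by rewrite size_char_poly szrs ltnn.
have ubA : ubound [set x : R | eigenvalue A x]%classic m by move=> b /leAm.
have -> : lambda1 A = m.
  apply/eqP; rewrite eq_le; apply/andP; split.
    by apply: ge_sup => //; exists m.
  by apply: ub_le_sup => //; exists m.
by [].
Qed.

Definition has_nonneg_lambda1_eigenvector (R : realType) (n : nat)
    (A : 'M[R]_n) : Prop :=
  exists x : 'rV[R]_n,
    [/\ x != 0, x *m A = lambda1 A *: x & forall i, 0 <= x 0 i].

Definition local_bound (R : realType) (n : nat) (G G' : sgraph n) : R :=
  Num.sqrt (2 * \sum_(e in pos_edges G')
                   (((c_b G e)%:R - 1) / (c_b G e)%:R)).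

(* Main.v *)
(* Let x >= 0 be an eigenvector of the switched graph for lambda_1, and put
   y_i = x_i^2.  Dropping the negative edges and applying Cauchy-Schwarz with
   the weights c/(c-1) reduces the bound to a localised Motzkin-Straus
   inequality: the form y |-> sum c(e)/(c(e)-1) y_i y_j over ordered positive
   edges is at most (sum y_i)^2 on nonnegative vectors.  It follows by moving
   weight between non-adjacent vertices until the support is a clique.

   In the equality case, vertices outside the support of x can be switched
   freely, which forces all edges into the support and makes them positive.
   Second-order optimality of y shows that non-adjacency is transitive on the
   support, so the graph is complete multipartite; all products x_i x_j over
   edges are then equal, which gives parts of equal size from three parts on.
   Conversely, the bound is at most mu := sqrt(2 |E| (omega-1)/omega), and mu is
   an eigenvalue with an explicit eigenvector, signed by a potential. *)
Require Import Defs.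
From mathcomp Require Import all_boot all_order all_algebra.
From mathcomp Require Import boolp classical_sets reals.
From mathcomp Require Import complex ring lra.
From mathcomp Require Import fintype finset.

Set Implicit Arguments.
Unset Strict Implicit.
Unset Printing Implicit Defensive.

Import Order.TTheory GRing.Theory Num.Theory.

Local Open Scope ring_scope.

(** * The local Motzkin-Straus inequality *)

Section QuadraticForm.
Variables (R : realType) (n : nat).
Implicit Types (M : 'M[R]_n) (u v y : 'rV[R]_n).

Definition bform M u v : R := (u *m M *m v^T) 0 0.

Lemma bformE M u v : bform M u v = \sum_i \sum_j u 0 i * M i j * v 0 j.
Proof.
rewrite /bform mxE exchange_big; apply: eq_bigr => j _.
by rewrite !mxE mulr_suml; apply: eq_bigr => i _.
Qed.

Lemma bformDl M u u' v : bform M (u + u') v = bform M u v + bform M u' v.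
Proof. by rewrite /bform !mulmxDl mxE. Qed.

Lemma bformDr M u v v' : bform M u (v + v') = bform M u v + bform M u v'.
Proof. by rewrite /bform linearD mulmxDr mxE. Qed.

Lemma bformZl M a u v : bform M (a *: u) v = a * bform M u v.
Proof. by rewrite /bform -!scalemxAl mxE. Qed.

Lemma bformZr M a u v : bform M u (a *: v) = a * bform M u v.
Proof. by rewrite /bform linearZ -scalemxAr mxE. Qed.

Lemma bform_delta M i j : bform M (delta_mx 0 i) (delta_mx 0 j) = M i j.
Proof.
rewrite /bform -rowE trmx_delta mxE (bigD1 j) //= big1 => [|k nkj].
  by rewrite !mxE !eqxx mulr1 addr0.
by rewrite !mxE (negPf nkj) mulr0.
Qed.

Definition mass y : R := \sum_i y 0 i.

Lemma massD u v : mass (u + v) = mass u + mass v.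
Proof. by rewrite /mass -big_split; apply: eq_bigr => i _; rewrite mxE. Qed.

Lemma massZ a u : mass (a *: u) = a * mass u.
Proof. by rewrite /mass mulr_sumr; apply: eq_bigr => i _; rewrite mxE. Qed.

Lemma mass_delta i : mass (delta_mx 0 i) = 1.
Proof.
rewrite /mass (bigD1 i) //= big1 => [|k nki]; rewrite !mxE ?eqxx ?addr0 //.
by rewrite (negPf nki) andbF.
Qed.

(** Cauchy-Schwarz against the constant vector, from the non-negative sum of squared deviations
    [#|K| * y_i - s], scaled to avoid dividing by [#|K|]. *)
Lemma sqr_sum_le_card (K : {set 'I_n}) y :
  (\sum_(i in K) y 0 i) ^+ 2 <= #|K|%:R * \sum_(i in K) y 0 i ^+ 2.
Proof.
have [->|[i0 i0K]] := set_0Vmem K; first by rewrite !big_set0 cards0; lra.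
have k0 : 0 < #|K|%:R :> R by rewrite ltr0n; apply/card_gt0P; exists i0.
set s := \sum_(i in K) _; set q := \sum_(i in K) _.
have : 0 <= \sum_(i in K) (#|K|%:R * y 0 i - s) ^+ 2.
  by apply: sumr_ge0 => i _; apply: sqr_ge0.
have -> : \sum_(i in K) (#|K|%:R * y 0 i - s) ^+ 2
          = #|K|%:R * (#|K|%:R * q - s ^+ 2).
  rewrite (eq_bigr (fun i => #|K|%:R ^+ 2 * y 0 i ^+ 2 +
     ((- (2 * #|K|%:R * s)) * y 0 i + s ^+ 2))) => [|i _]; last by ring.
  rewrite big_split /= big_split /= -!mulr_sumr sumr_const -/s -/q.
  by rewrite -mulr_natr; ring.
by rewrite pmulr_rge0 // subr_ge0.
Qed.

Definition msupp y : {set 'I_n} := [set i | y 0 i != 0].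

(** Zero entries of [M] encode non-adjacency, and [k / (k - 1)] is the constant weight for which the
    form on a clique of order [k] equals [mass ^ 2] at the uniform vector. *)
Definition clique_bounded M :=
  forall K : {set 'I_n}, (1 < #|K|)%N ->
    {in K &, forall i j, i != j -> M i j != 0} ->
    {in K &, forall i j, i != j -> M i j <= #|K|%:R / (#|K|%:R - 1)}.

(** On a clique of order [k > 1], with sum [s] and sum of squares [q], the form is at most
    [k / (k - 1) * (s ^ 2 - q)]; then [s ^ 2 <= k * q] concludes. *)
Lemma bform_clique_supp M y :
  (forall i, M i i = 0) -> clique_bounded M -> (forall i, 0 <= y 0 i) ->
  {in msupp y &, forall i j, i != j -> M i j != 0} ->
  bform M y y <= mass y ^+ 2.
Proof.
move=> M0 cM y0 cK; set K := msupp y in cK.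
have yK i : i \notin K -> y 0 i = 0 by rewrite inE negbK => /eqP.
have tK : mass y = \sum_(i in K) y 0 i.
  rewrite /mass (bigID (mem K)) /= [X in _ + X]big1 ?addr0 //.
have qK : bform M y y = \sum_(i in K) \sum_(j in K) y 0 i * M i j * y 0 j.
  rewrite bformE (bigID (mem K)) /= [X in _ + X]big1 ?addr0; last first.
    by move=> i /yK ->; rewrite big1 // => j _; rewrite !mul0r.
  apply: eq_bigr => i _; rewrite (bigID (mem K)) /= [X in _ + X]big1 ?addr0 //.
  by move=> j /yK ->; rewrite mulr0.
have [K1|K1] := leqP #|K| 1.
  (* At most one support vertex leaves only diagonal entries, which vanish. *)
  rewrite qK big1 ?sqr_ge0 // => i iK; rewrite big1 // => j jK.
  suff -> : j = i by rewrite M0 mulr0 mul0r.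
  by have /card_le1P/(_ i iK j) := K1; rewrite jK inE => /esym/eqP.
have bM := cM K K1 cK.
set k : R := #|K|%:R in bM *.
have k1 : 1 < k by rewrite /k ltr1n.
apply: (@le_trans _ _ (k / (k - 1) *
   ((\sum_(i in K) y 0 i) ^+ 2 - \sum_(i in K) y 0 i ^+ 2))).
  rewrite expr2 mulr_suml -sumrB mulr_sumr qK; apply: ler_sum => i iK.
  rewrite mulr_sumr (bigD1 i) //= M0 mulr0 mul0r add0r.
  rewrite [X in _ * (X - _)](bigD1 i) //= -expr2 addrC addrK mulr_sumr.
  apply: ler_sum => j /andP[jK nji].
  rewrite -mulrA mulrCA; apply: ler_wpM2r; first by rewrite mulr_ge0.
  by apply: bM; rewrite // eq_sym.
have := sqr_sum_le_card K y; rewrite -/k tK.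
set s := _ ^+ 2; set q := \sum_(i in K) _ => sq.
rewrite mulrAC ler_pdivrMr; last by lra.
nra.
Qed.

(* Moving all the weight of one of two non-adjacent support vertices to the
   other is affine in the form, so one of the two moves does not decrease it. *)
Theorem local_motzkin_straus M y :
  (forall i j, M i j = M j i) -> (forall i, M i i = 0) -> clique_bounded M ->
  (forall i, 0 <= y 0 i) -> bform M y y <= mass y ^+ 2.
Proof.
move=> symM M0 cM; have [m] := ubnP #|msupp y|; elim: m y => // m IH y lem y0.
have [/existsP[i /existsP[j]]|nex] := boolP [exists i, exists j,
   [&& i \in msupp y, j \in msupp y, i != j & M i j == 0]]; last first.
  apply: bform_clique_supp => // i j iK jK nij; apply: contra nex => Mij.
  by apply/existsP; exists i; apply/existsP; exists j; apply/and4P.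
case/and4P=> iK jK nij /eqP Mij.
have yi : 0 < y 0 i by rewrite lt_neqAle y0 andbT eq_sym; rewrite inE in iK.
have yj : 0 < y 0 j by rewrite lt_neqAle y0 andbT eq_sym; rewrite inE in jK.
pose d : 'rV[R]_n := delta_mx 0 i - delta_mx 0 j.
have dE l : d 0 l = (l == i)%:R - (l == j)%:R.
  by rewrite !mxE eqxx /=.
have Bdd : bform M d d = 0.
  rewrite /d -scaleN1r !(bformDl, bformDr, bformZl, bformZr) !bform_delta.
  by rewrite !M0 (symM j i) Mij; ring.
have td : mass d = 0.
  by rewrite /d -scaleN1r massD massZ !mass_delta; ring.
clearbody d; pose y1 := y + y 0 j *: d; pose y2 := y - y 0 i *: d.
have step a l0 : l0 \in msupp y -> (y + a *: d) 0 l0 = 0 ->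
    (forall l, 0 <= (y + a *: d) 0 l) ->
    bform M (y + a *: d) (y + a *: d) <= mass y ^+ 2.
  move=> l0K zl0 pos.
  have -> : mass y = mass (y + a *: d) by rewrite massD massZ td mulr0 addr0.
  apply: IH => //; rewrite ltnS in lem; apply: leq_trans lem; apply: proper_card.
  apply/properP; split; last by exists l0 => //; rewrite inE zl0 eqxx.
  apply/subsetP => l; apply: contraTT => lK.
  have [li|li] := eqVneq l i; first by rewrite li iK in lK.
  have [lj|lj] := eqVneq l j; first by rewrite lj jK in lK.
  have := lK; rewrite !inE !negbK mxE [(_ *: d) 0 l]mxE dE (negPf li) (negPf lj).
  by rewrite subr0 mulr0 addr0.
have B1 : bform M y1 y1 <= mass y ^+ 2.
  apply: (step _ j) => //.
    by rewrite mxE [(_ *: d) 0 j]mxE dE eqxx eq_sym (negPf nij) /=; lra.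
  move=> l; rewrite mxE [(_ *: d) 0 l]mxE dE; have := y0 l.
  have [->|li] := eqVneq l i; first by rewrite (negPf nij) /=; lra.
  by have [->|lj] := eqVneq l j; rewrite /=; lra.
have B2 : bform M y2 y2 <= mass y ^+ 2.
  rewrite /y2 -scaleNr; apply: (step _ i) => //.
    by rewrite mxE [(_ *: d) 0 i]mxE dE eqxx (negPf nij) /=; lra.
  move=> l; rewrite mxE [(_ *: d) 0 l]mxE dE; have := y0 l.
  have [->|li] := eqVneq l i; first by rewrite (negPf nij) /=; lra.
  by have [->|lj] := eqVneq l j; rewrite /=; lra.
(* The bounds read [b + y_j (c + e) <= t] and [b - y_i (c + e) <= t]; weighting them by [y_i] and
   [y_j] cancels the cross terms. *)
move: B1 B2; rewrite /y1 /y2 -scaleNr !(bformDl, bformDr, bformZl, bformZr) Bdd.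
rewrite !mulr0 !addr0.
set b := bform M y y; set c := bform M y d; set e := bform M d y.
set t := mass y ^+ 2 => B1 B2; nra.
Qed.

(* Second-order optimality along [e_i - 2 e_j + e_k]. *)
Lemma motzkin_straus_eq_trans M y :
  (forall i j, M i j = M j i) -> (forall i, M i i = 0) -> clique_bounded M ->
  (forall i j, 0 <= M i j) ->
  (forall i, 0 <= y 0 i) -> bform M y y = mass y ^+ 2 ->
  forall i j k, 0 < y 0 i -> 0 < y 0 j -> 0 < y 0 k ->
    M i j = 0 -> M j k = 0 -> M i k = 0.
Proof.
move=> symM M0 cM Mge0 y0 eqy i j k yi yj yk Mij Mjk.
apply/eqP; rewrite eq_le Mge0 andbT leNgt; apply/negP => Mik.
have nij : i != j by apply/eqP => e; move: Mik; rewrite e Mjk ltxx.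
have njk : k != j by apply/eqP => e; move: Mik; rewrite e Mij ltxx.
have nik : i != k by apply/eqP => e; move: Mik; rewrite e M0 ltxx.
pose d : 'rV[R]_n := delta_mx 0 i + (-2) *: delta_mx 0 j + delta_mx 0 k.
have dE l : d 0 l = (l == i)%:R - 2 * (l == j)%:R + (l == k)%:R.
  by rewrite !mxE eqxx /= mulNr.
have td : mass d = 0 by rewrite /d !massD massZ !mass_delta; ring.
have Bdd : bform M d d = 2 * M i k.
  rewrite /d !(bformDl, bformDr, bformZl, bformZr) !bform_delta.
  by rewrite !M0 (symM j i) (symM k j) (symM k i) Mij Mjk; ring.
clearbody d.
(* The coordinate [j] of [d] is -2, so half the minimum keeps both [y + s d] and [y - s d]
   non-negative. *)
pose s := Num.min (y 0 i) (Num.min (y 0 j) (y 0 k)) / 2.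
have [s0 si sj sk] : [/\ 0 < s, 2 * s <= y 0 i, 2 * s <= y 0 j & 2 * s <= y 0 k].
  have -> : 2 * s = Num.min (y 0 i) (Num.min (y 0 j) (y 0 k)).
    by rewrite /s; field.
  by rewrite /s divr_gt0 ?lt_min ?yi ?yj ?yk //; split=> //;
     rewrite !ge_min lexx ?orbT.
have main a : a = s \/ a = - s -> bform M (y + a *: d) (y + a *: d) <= mass y ^+ 2.
  move=> aE.
  have -> : mass y = mass (y + a *: d) by rewrite massD massZ td mulr0 addr0.
  apply: local_motzkin_straus => // l.
  rewrite mxE [(_ *: d) 0 l]mxE dE; have := y0 l.
  have [->|li] := eqVneq l i; first by rewrite (negPf nij) (negPf nik) /=; case: aE; lra.
  have [->|lj] := eqVneq l j; first by rewrite eq_sym (negPf njk) /=; case: aE; lra.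
  by have [->|lk] := eqVneq l k; rewrite /=; case: aE; lra.
(* Adding the two bounds cancels the linear terms and leaves [s ^ 2 * M i k <= 0]. *)
have := main s (or_introl erefl); have := main (- s) (or_intror erefl).
rewrite !(bformDl, bformDr, bformZl, bformZr) Bdd eqy.
set c := bform M y d; set e := bform M d y; set t := mass y ^+ 2.
have := mulr_gt0 (mulr_gt0 s0 s0) Mik; lra.
Qed.

(** The characteristic polynomial has a complex root [a], with eigenvector [v]. Evaluating [v A v^*]
    in two ways gives [a N = a^* N] with [N] the non-zero squared norm of [v], so [a] is real. *)
Lemma symmetric_eigenvalue (A : 'M[R]_n) :
  (0 < n)%N -> A^T = A -> exists a, eigenvalue A a.
Proof.
move=> n0 symA.
pose AC := map_mx (real_complex R) A.
have [a rta] : exists a, root (char_poly AC) a.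
  apply/closed_rootP; rewrite size_char_poly; by case: (n) n0.
move: (rta); rewrite -eigenvalue_root_char => /eigenvalueP[v vA nz].
pose vb := map_mx (fun z : R[i] => z^*) v.
pose N := (v *m vb^T) 0 0.
have NE : N = \sum_i `|v 0 i| ^+ 2.
  by rewrite /N mxE; apply: eq_bigr => i _; rewrite !mxE -normCK.
have N0 : N != 0.
  rewrite NE psumr_neq0; last by move=> i _; rewrite exprn_ge0.
  apply: contraR nz => /hasPn H; apply/eqP/rowP => i; rewrite mxE.
  have := H i (mem_index_enum i); rewrite /= lt_neqAle exprn_ge0 // andbT negbK.
  by rewrite eq_sym expf_eq0 /= normr_eq0 => /eqP.
have vbA : vb *m AC = a^* *: vb.
  have := congr1 (map_mx (fun z : R[i] => z^*)) vA.
  rewrite map_mxZ map_mxM => <-; congr (_ *m _).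
  apply/matrixP => i j; rewrite !mxE; apply/esym/CrealP/complex_realP.
  by exists (A i j).
have symAC : AC^T = AC by rewrite /AC map_trmx symA.
have : (v *m AC *m vb^T) 0 0 = (v *m (vb *m AC)^T) 0 0.
  by rewrite trmx_mul symAC mulmxA.
rewrite vA vbA -scalemxAl linearZ -scalemxAr.
rewrite [LHS]mxE [RHS]mxE -/N.
move=> /(mulIf N0) aR.
have ra : a \is Num.real by apply/CrealP.
have [r ar] := complex_realP _ ra.
exists r; move: rta; rewrite eigenvalue_root_char ar /AC -map_char_poly.
by rewrite fmorph_root.
Qed.

End QuadraticForm.

(** * Balance and switching *)

Lemma odd_count_addb (T : Type) (a b : pred T) (s : seq T) :
  odd (count (fun v => a v (+) b v) s) = odd (count a s) (+) odd (count b s).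
Proof.
elim: s => //= v s IH; rewrite !oddD IH.
by case: (a v); case: (b v); case: (odd (count a s)); case: (odd (count b s)).
Qed.

Section BalancedCliques.
Variables (n : nat) (G : sgraph n).
Implicit Types (S e : {set 'I_n}) (th : 'I_n -> bool).

Definition pos_adj : rel 'I_n := fun u v => adj G u v && ~~ neg G u v.

Lemma pos_adj_sym : symmetric pos_adj.
Proof. by move=> u v; rewrite /pos_adj adj_sym neg_sym. Qed.

(** Since [next c] permutes the cycle, every vertex contributes its potential twice to the parity of
    negative edges. *)
Lemma balanced_cycle_potential th c :
  is_cycle G c ->
  {in c &, forall u v, adj G u v -> neg G u v = th u (+) th v} ->
  balanced_cycle G c.
Proof.
case/andP=> _ /andP[cyc Uc] thE; rewrite /balanced_cycle.
rewrite (@eq_in_count _ _ (fun v => th v (+) th (next c v))); last first.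
  by move=> v vc; rewrite thE ?mem_next // next_cycle.
rewrite odd_count_addb -(count_map (next c) th).
suff /permP-> : perm_eq (map (next c) c) c by rewrite addbb.
have Um : uniq (map (next c) c).
  rewrite map_inj_in_uniq // => u v _ _ /(congr1 (prev c)).
  by rewrite !prev_next.
apply: uniq_perm => //.
apply: (uniq_min_size Um _ _).2; last by rewrite size_map.
by move=> v /mapP[u uc ->]; rewrite mem_next.
Qed.

Lemma balanced_clique_potential th S :
  {in S &, forall u v, u != v -> adj G u v} ->
  {in S &, forall u v, adj G u v -> neg G u v = th u (+) th v} ->
  balanced_clique G S.
Proof.
move=> clS thE; split=> // c cS cyc; apply: (balanced_cycle_potential cyc).
by move=> u v /cS uS /cS vS; apply: thE.
Qed.

Lemma leq_omega_b S : balanced_clique G S -> (#|S| <= omega_b G)%N.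
Proof.
by move=> bS; apply: (@leq_bigmax_cond _ _ (fun S : {set 'I_n} => #|S|)); apply/asboolP.
Qed.

Lemma leq_c_b S e : balanced_clique G S -> e \subset S -> (#|S| <= c_b G e)%N.
Proof.
move=> bS eS; apply: (@leq_bigmax_cond _ _ (fun S : {set 'I_n} => #|S|)).
by rewrite eS andbT; apply/asboolP.
Qed.

Lemma c_b_leq_omega_b e : (c_b G e <= omega_b G)%N.
Proof. by apply/bigmax_leqP => S /andP[/asboolP bS _]; apply: leq_omega_b. Qed.

Lemma omega_b_attained : exists2 S, balanced_clique G S & #|S| = omega_b G.
Proof.
(* The empty clique ensures that the maximum ranges over a non-empty family. *)
have b0 : `[< balanced_clique G set0 >].
  by apply/asboolP; apply: (@balanced_clique_potential xpredT) => u v; rewrite inE.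
have : (0 < #|[pred S : {set 'I_n} | `[< balanced_clique G S >]]|)%N.
  by apply/card_gt0P; exists set0.
case/(eq_bigmax_cond (fun S : {set 'I_n} => #|S|)) => S /asboolP bS E.
by exists S => //; rewrite /omega_b E.
Qed.

Lemma c_b_edge_ge2 u v : adj G u v -> (2 <= c_b G [set u; v])%N.
Proof.
move=> uv; have nuv : u != v by apply: contraTneq uv => ->; rewrite adj_irr.
have <- : #|[set u; v]| = 2%N by rewrite cards2 nuv.
apply: leq_c_b => //.
apply: (@balanced_clique_potential (fun w => (w == u) && neg G u v)).
  move=> a b; rewrite !inE => /orP[]/eqP-> /orP[]/eqP->; rewrite ?eqxx // => _.
  by rewrite adj_sym.
move=> a b; rewrite !inE => /orP[]/eqP-> /orP[]/eqP->; rewrite ?adj_irr //.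
  by rewrite eqxx eq_sym (negPf nuv) addbF.
by rewrite eqxx eq_sym (negPf nuv) neg_sym.
Qed.

Lemma omega_b_ge2_edge : (2 <= omega_b G)%N -> exists u v, adj G u v.
Proof.
have [S [clS _] <-] := omega_b_attained => /card_gt1P[u [v [uS vS nuv]]].
by exists u, v; apply: clS.
Qed.

(** The factor 2 of the bound is absorbed here: each edge is counted once in either direction, so
    later sums run over ordered pairs. *)
Lemma sum_pos_edges (R : realType) (g : {set 'I_n} -> R) :
  2 * \sum_(e in pos_edges G) g e =
  \sum_(p : 'I_n * 'I_n | pos_adj p.1 p.2) g [set p.1; p.2].
Proof.
rewrite mulr_sumr [RHS](partition_big (fun p => [set p.1; p.2]) (mem (pos_edges G))) /=;
  last first.
  move=> [u v] /= uv; rewrite inE; apply/existsP; exists u; apply/existsP; exists v.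
  by rewrite eqxx.
apply: eq_bigr => e; rewrite inE => /existsP[u /existsP[v /and3P[/eqP-> auv nuv]]].
have puv : pos_adj u v by rewrite /pos_adj auv.
have uv : u != v by apply: contraTneq auv => ->; rewrite adj_irr.
rewrite (bigD1 (u, v)) /= ?puv ?eqxx // (bigD1 (v, u)) /=; last first.
  by rewrite pos_adj_sym puv setUC eqxx /= xpair_eqE eq_sym (negPf uv).
rewrite big1 ?addr0 => [|[a b] /= /andP[/andP[/andP[_ /eqP E] n1] n2]].
  by rewrite (setUC [set v]); ring.
have ab : #|[set a; b]| = 2%N by rewrite E cards2 uv.
have nab : a != b by apply: contra_eq_neq ab => ->; rewrite cards2 eqxx.
have : a \in [set u; v] by rewrite -E !inE eqxx.
have : b \in [set u; v] by rewrite -E !inE eqxx orbT.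
rewrite !inE => /orP[]/eqP eb /orP[]/eqP ea.
- by move: nab; rewrite ea eb eqxx.
- by move: n2; rewrite ea eb eqxx.
- by move: n1; rewrite ea eb eqxx.
- by move: nab; rewrite ea eb eqxx.
Qed.

End BalancedCliques.

(** * Switching, spectra and non-negative eigenvectors *)

Section Switching.
Variables (R : realType) (n : nat).
Implicit Types (G : sgraph n) (th : 'I_n -> bool) (x : 'rV[R]_n).

(** The action on row vectors of the diagonal sign matrix that conjugates the adjacency matrix of a
    graph into that of its switching. *)
Definition flip th x : 'rV[R]_n := \row_i ((-1) ^+ th i * x 0 i).

Lemma flipK th : involutive (flip th).
Proof. by move=> x; apply/rowP => i; rewrite !mxE signrMK. Qed.

Lemma flip_neq0 th x : x != 0 -> flip th x != 0.
Proof.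
apply: contra => /eqP E; rewrite -(flipK th x) E; apply/eqP/rowP => i.
by rewrite !mxE mulr0.
Qed.

Lemma adjmx_trmx G : (adjmx R G)^T = adjmx R G.
Proof. by apply/matrixP => i j; rewrite !mxE adj_sym neg_sym. Qed.

Lemma adjmx_switching G G' th i j : sgeq G' (switch G th) ->
  adjmx R G' i j = (-1) ^+ th i * adjmx R G i j * (-1) ^+ th j.
Proof.
move=> /(_ i j)[/= ea en]; rewrite !mxE -ea.
case: ifP => [/en->|_]; last by rewrite mulr0 mul0r.
by rewrite /switch_neg !signr_addb.
Qed.

Lemma flip_eigen G G' th x a : sgeq G' (switch G th) ->
  x *m adjmx R G = a *: x -> flip th x *m adjmx R G' = a *: flip th x.
Proof.
move=> sG /rowP E; apply/rowP => j; move: (E j); rewrite [LHS]mxE [RHS]mxE => Ej.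
rewrite [LHS]mxE [RHS]mxE [flip th x 0 j]mxE mulrCA -Ej mulr_sumr.
apply: eq_bigr => i _; rewrite [flip th x 0 i]mxE (adjmx_switching _ _ sG).
have := sqrr_sign R (th i); set s := (-1) ^+ th i => s2.
transitivity (s ^+ 2 * (x 0 i * adjmx R G i j * (-1) ^+ th j)); first by ring.
by rewrite s2; ring.
Qed.

Lemma sgeq_switch_sym G G' th : sgeq G' (switch G th) -> sgeq G (switch G' th).
Proof.
move=> sG u v; have [/= ea en] := sG u v; split=> //=; rewrite -ea => /en nE.
rewrite /switch_neg nE /switch_neg.
by case: (th u); case: (th v); case: (neg G u v).
Qed.

Lemma eigenvalue_switching G G' th a : sgeq G' (switch G th) ->
  eigenvalue (adjmx R G) a -> eigenvalue (adjmx R G') a.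
Proof.
move=> sG /eigenvalueP[v vA nz]; apply/eigenvalueP; exists (flip th v).
  exact: flip_eigen sG vA.
exact: flip_neq0.
Qed.

Lemma lambda1_switching G G' th : sgeq G' (switch G th) ->
  lambda1 (adjmx R G') = lambda1 (adjmx R G).
Proof.
move=> sG; rewrite /lambda1; congr sup; apply/seteqP; split=> a /=.
  exact: eigenvalue_switching (sgeq_switch_sym sG).
exact: eigenvalue_switching sG.
Qed.

(** Switching at the vertices where a top eigenvector is negative replaces its entries by their
    absolute values. This keeps the equality hypothesis of the theorem from being vacuous. *)
Lemma exists_nonneg_switching G : (0 < n)%N ->
  exists2 G', switching_equivalent G G' &
    has_nonneg_lambda1_eigenvector (adjmx R G').
Proof.
move=> n0; have [a Aa] := symmetric_eigenvalue n0 (adjmx_trmx G).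
have [/eigenvalueP[v vA nz] _] := lambda1_max Aa.
pose th i := v 0 i < 0.
have sG : sgeq (switch G th) (switch G th) by [].
exists (switch G th); first by exists th.
exists (flip th v); rewrite flip_neq0 // (lambda1_switching sG).
split=> //; first exact: flip_eigen sG vA.
move=> i; rewrite mxE /th; case: ltP => [vi|vi]; rewrite ?expr1 ?expr0; lra.
Qed.

End Switching.

(** * The spectral bound *)

Section LocalBound.
Variables (R : realType) (n : nat) (G G' : sgraph n) (th : 'I_n -> bool).
Hypothesis sG : sgeq G' (switch G th).
Variable x : 'rV[R]_n.
Hypotheses (x_neq0 : x != 0) (x_ge0 : forall i, 0 <= x 0 i).
Hypothesis x_eigen : x *m adjmx R G' = lambda1 (adjmx R G') *: x.

Let C i j : R := (c_b G [set i; j])%:R.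
Let P (p : 'I_n * 'I_n) := pos_adj G' p.1 p.2.
Let Neg (p : 'I_n * 'I_n) := adj G' p.1 p.2 && neg G' p.1 p.2.
Let lam := lambda1 (adjmx R G').

(** On positive edges these are the reciprocals of the terms of the bound, as Cauchy-Schwarz
    requires. *)
Definition local_weight : 'M[R]_n :=
  \matrix_(i, j) if pos_adj G' i j then C i j / (C i j - 1) else 0.

Definition sqr_row : 'rV[R]_n := \row_i x 0 i ^+ 2.

Let M := local_weight.
Let y := sqr_row.
Let N := mass y.
Let S := \sum_(p | P p) (C p.1 p.2 - 1) / C p.1 p.2.
Let Q := \sum_(p | P p) x 0 p.1 * x 0 p.2.
Let Qn := \sum_(p | Neg p) x 0 p.1 * x 0 p.2.

Lemma local_boundE : local_bound R G G' = Num.sqrt S.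
Proof.
by rewrite /local_bound (sum_pos_edges G' (fun e => ((c_b G e)%:R - 1) / (c_b G e)%:R)).
Qed.

Lemma switching_adjE u v : adj G u v = adj G' u v.
Proof. by have [/= ->] := sG u v. Qed.

Lemma pos_adj_potential u v : pos_adj G' u v -> neg G u v = th u (+) th v.
Proof.
case/andP=> auv; have [/= _ /(_ auv)->] := sG u v; rewrite /switch_neg.
by case: (th u); case: (th v); case: (neg G u v).
Qed.

Lemma pos_adj_C_ge2 i j : pos_adj G' i j -> 2 <= C i j.
Proof.
by case/andP=> aij _; rewrite ler_nat; apply: c_b_edge_ge2; rewrite switching_adjE.
Qed.

Lemma local_weight_sym i j : M i j = M j i.
Proof. by rewrite !mxE pos_adj_sym /C setUC. Qed.

Lemma local_weight_diag i : M i i = 0.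
Proof. by rewrite mxE /pos_adj adj_irr. Qed.

Lemma local_weight_gt0 i j : pos_adj G' i j -> 0 < M i j.
Proof.
by move=> pij; rewrite mxE pij; have := pos_adj_C_ge2 pij => ?; rewrite divr_gt0; lra.
Qed.

Lemma local_weight_ge0 i j : 0 <= M i j.
Proof.
have [pij|npij] := boolP (pos_adj G' i j); first exact/ltW/local_weight_gt0.
by rewrite mxE (negPf npij).
Qed.

Lemma local_weight_eq0 i j : (M i j == 0) = ~~ pos_adj G' i j.
Proof.
have [pij|npij] := boolP (pos_adj G' i j); last by rewrite mxE (negPf npij) eqxx.
by rewrite gt_eqF // local_weight_gt0.
Qed.

(** The switching function [th] is a potential for [G] on the positive edges of [G']. This links the
    cliques of the weight matrix to [c_b]. *)
Lemma pos_clique_balanced (K : {set 'I_n}) :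
  {in K &, forall i j, i != j -> pos_adj G' i j} -> balanced_clique G K.
Proof.
move=> clK; apply: (@balanced_clique_potential _ _ th) => u v uK vK.
  by move/(clK u v uK vK)/andP=> []; rewrite switching_adjE.
move=> auv; apply/pos_adj_potential/clK => //.
by apply: contraTneq auv => ->; rewrite adj_irr.
Qed.

(** A positive clique [K] containing an edge forces [c >= #|K|] there, and [c / (c - 1)] decreases
    in [c]. *)
Lemma local_weight_clique_bounded : clique_bounded M.
Proof.
move=> K K1 clK i j iK jK nij.
have {}clK : {in K &, forall i j, i != j -> pos_adj G' i j}.
  by move=> u v uK vK nuv; have := clK u v uK vK nuv; rewrite local_weight_eq0 negbK.
have CK : #|K|%:R <= C i j.
  rewrite ler_nat; apply: leq_c_b; first exact: pos_clique_balanced.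
  by apply/subsetP => l; rewrite !inE => /orP[]/eqP->.
have K2 : 2 <= #|K|%:R :> R by rewrite ler_nat.
rewrite mxE clK // ler_pdivrMr; last by lra.
by rewrite mulrAC ler_pdivlMr; lra.
Qed.

Lemma sqr_row_ge0 i : 0 <= y 0 i.
Proof. by rewrite mxE sqr_ge0. Qed.

Lemma mass_sqr_row_gt0 : 0 < N.
Proof.
rewrite lt_neqAle eq_sym sumr_ge0 ?andbT => [|i _]; last exact: sqr_row_ge0.
apply: contra x_neq0 => /eqP/psumr_eq0P E; apply/eqP/rowP => i.
have := E (fun i _ => sqr_row_ge0 i) i isT; rewrite !mxE => /eqP.
by rewrite sqrf_eq0 => /eqP.
Qed.

Lemma bform_local_weight : bform M y y =
  \sum_(p | P p) C p.1 p.2 / (C p.1 p.2 - 1) * (x 0 p.1 * x 0 p.2) ^+ 2.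
Proof.
rewrite bformE pair_big /= [RHS]big_mkcond; apply: eq_bigr => [[i j]] _ /=.
by rewrite !mxE /P /=; case: ifP => _; ring.
Qed.

(** The eigenvector equation paired with [x], with the positive and negative edges separated. *)
Lemma lambda1_decomposition : lam * N = Q - Qn.
Proof.
have /(congr1 (fun z => (z *m x^T) 0 0)) := x_eigen.
rewrite -scalemxAl -/(bform _ x x) bformE pair_big /= [RHS]mxE -/lam => E.
transitivity (lam * (x *m x^T) 0 0).
  by congr (_ * _); rewrite mxE; apply: eq_bigr => i _; rewrite !mxE expr2.
rewrite -E /Q /Qn [\sum_(p | P p) _]big_mkcond [\sum_(p | Neg p) _]big_mkcond -sumrB.
apply: eq_bigr => [[i j]] _ /=; rewrite mxE /P /Neg /pos_adj /=.
by case: (adj _ _ _); case: (neg _ _ _) => /=; rewrite ?expr1 ?expr0; ring.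
Qed.

Lemma neg_sum_ge0 : 0 <= Qn.
Proof. by apply: sumr_ge0 => p _; rewrite mulr_ge0. Qed.

Lemma term_ge_half p : P p -> 1 / 2 <= (C p.1 p.2 - 1) / C p.1 p.2.
Proof.
by move/pos_adj_C_ge2 => ?; rewrite ler_pdivlMr; lra.
Qed.

Lemma bound_sum_ge0 : 0 <= S.
Proof. by apply: sumr_ge0 => p /term_ge_half; lra. Qed.

Lemma bound_sum_gt0 i j : pos_adj G' i j -> 0 < S.
Proof.
move=> pij; rewrite /S (bigD1 (i, j)) //=.
have := @term_ge_half (i, j) pij => /= ?.
rewrite ltr_pwDl //; first by lra.
by apply: sumr_ge0 => p /andP[/term_ge_half ? _]; lra.
Qed.

(** Cauchy-Schwarz in the form of an exact identity: the deficit of the bound is a weighted sum of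
    squares, the Motzkin-Straus deficit and the loss from negative edges. The value of [t] is the
    one with [t * S = lam * N]. Equality can then be read off term by term. *)
Lemma bound_gap (t := lam * N / S) : 0 < S ->
  \sum_(p | P p) C p.1 p.2 / (C p.1 p.2 - 1) *
     (x 0 p.1 * x 0 p.2 - t * ((C p.1 p.2 - 1) / C p.1 p.2)) ^+ 2
  + (N ^+ 2 - bform M y y) + 2 * t * Qn = N ^+ 2 * (S - lam ^+ 2) / S.
Proof.
move=> S0; pose F := bform M y y.
have -> : \sum_(p | P p) C p.1 p.2 / (C p.1 p.2 - 1) *
     (x 0 p.1 * x 0 p.2 - t * ((C p.1 p.2 - 1) / C p.1 p.2)) ^+ 2
   = F - 2 * t * Q + t ^+ 2 * S.
  rewrite /F bform_local_weight /Q /S !mulr_sumr -sumrB -big_split /=.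
  apply: eq_bigr => [[i j]] /= /pos_adj_C_ge2 Cij; field.
  by apply/andP; split; apply/eqP; lra.
have E : Q = lam * N + Qn by rewrite lambda1_decomposition; ring.
by rewrite E -/F /t; field; rewrite gt_eqF.
Qed.

Lemma gap_term_ge0 t p : P p -> 0 <= C p.1 p.2 / (C p.1 p.2 - 1) *
     (x 0 p.1 * x 0 p.2 - t * ((C p.1 p.2 - 1) / C p.1 p.2)) ^+ 2.
Proof.
move/pos_adj_C_ge2 => Cp; apply: mulr_ge0; last exact: sqr_ge0.
by rewrite divr_ge0; lra.
Qed.

Lemma bform_le_mass : bform M y y <= N ^+ 2.
Proof.
apply: local_motzkin_straus;
  [exact: local_weight_sym | exact: local_weight_diag
  | exact: local_weight_clique_bounded | exact: sqr_row_ge0].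
Qed.

Lemma lambda1_le_local_bound : lambda1 (adjmx R G') <= local_bound R G G'.
Proof.
rewrite local_boundE -/lam; have N0 := mass_sqr_row_gt0.
have [lam0|lam0] := lerP lam 0; first exact: le_trans (sqrtr_ge0 _).
(* Without positive edges [Q] would vanish and [lam * N = - Qn] could not be positive. *)
have S0 : 0 < S.
  have [/existsP[i /existsP[j pij]]|nex] :=
    boolP [exists i, exists j, pos_adj G' i j]; first exact: bound_sum_gt0 pij.
  have Q0 : Q = 0.
    apply: big1 => [[i j]] pij; case/negP: nex.
    by apply/existsP; exists i; apply/existsP; exists j.
  have := lambda1_decomposition; rewrite Q0.
  by have := neg_sum_ge0; have := mulr_gt0 lam0 N0; lra.
have := bound_gap S0; set D := \sum_(p | P p) _ => gap.
have D0 : 0 <= D by apply: sumr_ge0 => p; apply: gap_term_ge0.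
have t0 : 0 <= 2 * (lam * N / S) * Qn.
  by rewrite mulr_ge0 ?neg_sum_ge0 // mulr_ge0 // divr_ge0 ?mulr_ge0 // ltW.
have : 0 <= N ^+ 2 * (S - lam ^+ 2) / S.
  by rewrite -gap; have := bform_le_mass; lra.
rewrite pmulr_lge0 ?invr_gt0 // pmulr_rge0 ?exprn_gt0 // subr_ge0.
by move=> le; rewrite -(ler_sqr (ltW lam0)) ?nnegrE ?sqrtr_ge0 // sqr_sqrtr // ltW.
Qed.

(** * The equality case of the bound *)

Hypothesis eq_bound : lambda1 (adjmx R G') = local_bound R G G'.

Lemma eq_bound_sqr : lam ^+ 2 = S.
Proof. by rewrite /lam eq_bound local_boundE sqr_sqrtr // bound_sum_ge0. Qed.

Lemma eq_bound_ge0 : 0 <= lam.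
Proof. by rewrite /lam eq_bound local_boundE sqrtr_ge0. Qed.

(** The right-hand side of [bound_gap] is now zero, so each of its non-negative summands vanishes;
    [t > 0] because [lam ^ 2 = S > 0]. *)
Lemma eq_bound_parts (t := lam * N / S) : 0 < S ->
  [/\ 0 < t,
      forall p, P p -> x 0 p.1 * x 0 p.2 = t * ((C p.1 p.2 - 1) / C p.1 p.2),
      bform M y y = N ^+ 2 & Qn = 0].
Proof.
move=> S0; have := bound_gap S0; rewrite -/t eq_bound_sqr subrr mulr0 mul0r.
have lam0 : 0 < lam.
  rewrite lt_neqAle eq_bound_ge0 andbT eq_sym; apply: contraTneq S0 => l0.
  by rewrite -eq_bound_sqr l0 expr0n ltxx.
have t0 : 0 < t by rewrite divr_gt0 // mulr_gt0 // mass_sqr_row_gt0.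
set D := \sum_(p | P p) _ => gap.
have D0 : 0 <= D by apply: sumr_ge0 => p; apply: gap_term_ge0.
have := bform_le_mass; have Qn0 := neg_sum_ge0; have := mulr_ge0 (ltW t0) Qn0 => tq0 F0.
have tq : t * Qn = 0 by lra.
have D00 : D = 0 by lra.
split=> //; last 2 first.
- by lra.
- by apply/eqP; move/eqP: tq; rewrite mulf_eq0 gt_eqF.
move=> p pp; have /psumr_eq0P := D00 => /(_ (fun p => @gap_term_ge0 t p)) /(_ p pp) /eqP.
have Cp := pos_adj_C_ge2 pp.
rewrite mulf_eq0 sqrf_eq0 subr_eq0 => /orP[|/eqP//].
by rewrite gt_eqF // divr_gt0; lra.
Qed.

Lemma eq_bound_pos_supp i j : pos_adj G' i j -> 0 < x 0 i /\ 0 < x 0 j.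
Proof.
move=> pij; have [t0 E _ _] := eq_bound_parts (bound_sum_gt0 pij).
have xx : 0 < x 0 i * x 0 j.
  rewrite (E (i, j) pij) mulr_gt0 //; have := @term_ge_half (i, j) pij => /=; lra.
by split; rewrite lt_neqAle x_ge0 andbT eq_sym; apply: contraTneq xx => ->;
   rewrite ?mul0r ?mulr0 ltxx.
Qed.

Lemma eq_bound_neg_supp i j : adj G' i j -> neg G' i j -> x 0 i * x 0 j = 0.
Proof.
move=> aij nij; have Qn0 : Qn = 0.
  have [S0|] := ltP 0 S; first by have [] := eq_bound_parts S0.
  (* If [S] is not positive there are no positive edges, and [lam], [Q] and hence [Qn] are all
     zero. *)
  move=> S0; have lam0 : lam = 0.
    apply/eqP; rewrite -sqrf_eq0 eq_bound_sqr; apply/eqP.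
    by have := bound_sum_ge0; lra.
  have := lambda1_decomposition; rewrite lam0 mul0r.
  suff -> : Q = 0 by move=> ?; lra.
  by apply: big1 => [[u v]] /bound_sum_gt0; lra.
have /psumr_eq0P := Qn0 => /(_ (fun p _ => mulr_ge0 (x_ge0 _) (x_ge0 _))).
by move/(_ (i, j)); apply; rewrite /Neg /= aij.
Qed.

(** Once all edges are positive, non-adjacency is the vanishing of [M], and [sqr_row] is a maximiser
    of the form at its mass. *)
Lemma eq_bound_nonadj_trans i j k : (forall u v, adj G' u v -> pos_adj G' u v) ->
  (exists u v, adj G u v) ->
  0 < x 0 i -> 0 < x 0 j -> 0 < x 0 k ->
  ~~ adj G i j -> ~~ adj G j k -> ~~ adj G i k.
Proof.
move=> allpos [u [v]]; rewrite switching_adjE => /allpos puv xi xj xk.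
have [_ _ eqF _] := eq_bound_parts (bound_sum_gt0 puv).
have posE a b : ~~ adj G a b = (M a b == 0).
  rewrite local_weight_eq0 switching_adjE; congr (~~ _).
  by apply/idP/idP => [/allpos|/andP[]].
have y0 l : 0 < x 0 l -> 0 < y 0 l by move=> xl; rewrite mxE exprn_gt0.
rewrite !posE => /eqP Mij /eqP Mjk; apply/eqP.
apply: (motzkin_straus_eq_trans local_weight_sym local_weight_diag
  local_weight_clique_bounded local_weight_ge0 sqr_row_ge0 eqF _ _ _ Mij Mjk);
  exact: y0.
Qed.

Lemma eq_bound_product i j : pos_adj G' i j ->
  x 0 i * x 0 j = lam * N / S * ((C i j - 1) / C i j).
Proof. by move=> pij; have [_ /(_ (i, j) pij)] := eq_bound_parts (bound_sum_gt0 pij). Qed.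

End LocalBound.

(** * The extremal graphs *)

Section CompleteMultipartite.
Variables (n : nat) (G : sgraph n) (P : {set {set 'I_n}}).
Hypothesis GP : complete_multipartite_with G P.
Let W := cover P.

Let partP : partition P W := proj1 GP.

Lemma multi_adjE u v :
  adj G u v = [&& u \in W, v \in W & pblock P u != pblock P v].
Proof. by have [_ ->] := GP. Qed.

Lemma multi_trivIset : trivIset P.
Proof. by case/and3P: partP. Qed.

Lemma multi_part_nonempty B : B \in P -> exists u, u \in B.
Proof.
move=> BP; have [E|[u uB]] := set_0Vmem B; last by exists u.
by case/and3P: partP => _ _; rewrite -E BP.
Qed.

Lemma multi_pblockE B u : B \in P -> u \in B -> pblock P u = B.
Proof. by move=> BP; apply: def_pblock => //; apply: multi_trivIset. Qed.

Lemma multi_part_cover B u : B \in P -> u \in B -> u \in W.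
Proof. by move=> BP uB; apply/bigcupP; exists B. Qed.

Lemma multi_pblock_mem u : u \in W -> pblock P u \in P.
Proof. by move=> uW; apply: pblock_mem. Qed.

Lemma multi_nbrs B j : B \in P -> j \in B -> [set i | adj G i j] = W :\: B.
Proof.
move=> BP jB; apply/setP => i; rewrite !inE multi_adjE (multi_part_cover BP jB).
rewrite (multi_pblockE BP jB) /= andbC.
have [iW|] := boolP (i \in W); rewrite ?andbF ?andbT //; congr (~~ _).
apply/eqP/idP => [<-|/(multi_pblockE BP)//]; by rewrite mem_pblock.
Qed.

(** The map [pblock P] is injective on a clique. Order at least two excludes a lone isolated vertex,
    which lies in no part. *)
Lemma multi_clique_le_parts (S : {set 'I_n}) :
  {in S &, forall u v, u != v -> adj G u v} -> (1 < #|S|)%N -> (#|S| <= #|P|)%N.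
Proof.
move=> clS S1.
have SW u : u \in S -> u \in W.
  move=> uS; have [u1 [u2 [u1S u2S n12]]] := card_gt1P S1.
  have [E|nu] := eqVneq u u1; last first.
    by have := clS u u1 uS u1S nu; rewrite multi_adjE => /and3P[].
  by rewrite -E in u1S n12; have := clS _ _ u1S u2S n12; rewrite multi_adjE => /and3P[].
rewrite -(@card_in_imset _ _ (pblock P) S); last first.
  move=> u v uS vS Euv; apply/eqP; apply: contraT => nuv.
  by have := clS u v uS vS nuv; rewrite multi_adjE Euv eqxx !andbF.
by apply/subset_leq_card/subsetP => _ /imsetP[u /SW uW ->]; apply: multi_pblock_mem.
Qed.

(** A transversal of the parts, with [u] and [v] chosen in their own parts, is such a clique. *)
Lemma multi_clique_through u v : adj G u v ->
  exists K : {set 'I_n}, [/\ u \in K, v \in K, #|K| = #|P| &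
    {in K &, forall a b, a != b -> adj G a b}].
Proof.
move=> uv; have := uv; rewrite multi_adjE => /and3P[uW vW nuv].
pose rep (B : {set 'I_n}) :=
  (* The default [u] of [odflt] is never reached on a part, since parts are non-empty. *)
  if u \in B then u else if v \in B then v else odflt u [pick w in B].
have repB B : B \in P -> rep B \in B.
  move=> BP; rewrite /rep; case: ifP => // _; case: ifP => // _.
  case: pickP => [w //|no]; have [w] := multi_part_nonempty BP.
  by have /= -> := no w.
exists (rep @: P); split.
- apply/imsetP; exists (pblock P u); first exact: multi_pblock_mem.
  by rewrite /rep mem_pblock uW.
- apply/imsetP; exists (pblock P v); first exact: multi_pblock_mem.
  rewrite /rep mem_pblock vW; case: ifP => // uB.
  by move: nuv; rewrite (multi_pblockE (multi_pblock_mem vW) uB) eqxx.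
- apply: card_in_imset => B1 B2 B1P B2P E.
  by rewrite -(multi_pblockE B1P (repB _ B1P)) E (multi_pblockE B2P (repB _ B2P)).
- move=> _ _ /imsetP[B1 B1P ->] /imsetP[B2 B2P ->] nE; rewrite multi_adjE.
  rewrite (multi_part_cover B1P (repB _ B1P)) (multi_part_cover B2P (repB _ B2P)) /=.
  rewrite (multi_pblockE B1P (repB _ B1P)) (multi_pblockE B2P (repB _ B2P)).
  by apply: contraNneq nE => ->.
Qed.

(** Any vertex in a part other than those of [i] and [j] will do. *)
Lemma multi_common_nbr i j : i \in W -> j \in W -> (2 < #|P|)%N ->
  exists2 l, adj G i l & adj G j l.
Proof.
move=> iW jW P3.
have /card_gt0P[B] : (0 < #|P :\: [set pblock P i; pblock P j]|)%N.
  rewrite cardsD subn_gt0; apply: leq_ltn_trans P3.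
  apply: leq_trans (subset_leq_card (subsetIr _ _)) _.
  by rewrite cards2; case: (_ != _).
rewrite !inE negb_or => /andP[/andP[nBi nBj] BP].
have [l lB] := multi_part_nonempty BP.
exists l; rewrite multi_adjE ?iW ?jW (multi_part_cover BP lB) (multi_pblockE BP lB) /=;
  by rewrite eq_sym.
Qed.

(* A base edge [rq] fixes the potential; every other edge closes a triangle or
   a quadrilateral with it. *)
Lemma balanced_multi_potential : balanced G ->
  exists th, forall u v, adj G u v -> neg G u v = th u (+) th v.
Proof.
move=> bG.
have [/existsP[r /existsP[q rq]]|nex] :=
  boolP [exists r, exists q, adj G r q]; last first.
  exists xpredT => u v uv; case/negP: nex.
  by apply/existsP; exists u; apply/existsP; exists v.
(* The sign of a path from [r] to [v]: the edge itself when there is one, otherwise the path through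
   [q]. In particular [th r] is false. *)
pose th v := if adj G r v then neg G r v else neg G v q (+) neg G r q.
have adjN a b : adj G a b -> a != b.
  by apply: contraTneq => ->; rewrite adj_irr.
have triangle a b c : adj G a b -> adj G b c -> adj G c a ->
    neg G a b (+) neg G b c (+) neg G c a = false.
  move=> ab bc ca; have ac := adjN _ _ ca; rewrite eq_sym in ac.
  have := bG [:: a; b; c]; rewrite /is_cycle /ucycleb /= ab bc ca !inE !negb_or.
  rewrite (adjN _ _ ab) (adjN _ _ bc) ac /= => /(_ isT).
  rewrite /balanced_cycle /next /= !eqxx.
  rewrite ?(eq_sym b a) ?(eq_sym c b) ?(eq_sym c a).
  rewrite ?(negPf (adjN _ _ ab)) ?(negPf (adjN _ _ bc)) ?(negPf ac) /=.
  by case: (neg G a b); case: (neg G b c); case: (neg G c a).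
have square a b c d : a != c -> b != d ->
    adj G a b -> adj G b c -> adj G c d -> adj G d a ->
    neg G a b (+) neg G b c (+) neg G c d (+) neg G d a = false.
  move=> ac bd ab bc cd da; have ad := adjN _ _ da; rewrite eq_sym in ad.
  have := bG [:: a; b; c; d]; rewrite /is_cycle /ucycleb /= ab bc cd da !inE !negb_or.
  rewrite (adjN _ _ ab) (adjN _ _ bc) (adjN _ _ cd) ac ad bd /= => /(_ isT).
  rewrite /balanced_cycle /next /= !eqxx.
  rewrite ?(eq_sym b a) ?(eq_sym c b) ?(eq_sym c a).
  rewrite ?(eq_sym d a) ?(eq_sym d b) ?(eq_sym d c).
  rewrite ?(negPf (adjN _ _ ab)) ?(negPf (adjN _ _ bc)) ?(negPf (adjN _ _ cd)).
  rewrite ?(negPf ac) ?(negPf ad) ?(negPf bd) /=.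
  by case: (neg G a b); case: (neg G b c); case: (neg G c d); case: (neg G d a).
(* Here [u] lies in the part of [r], and the edge closes the quadrilateral [u v r q], which
   degenerates when [v = q] or [u = r]. *)
have half u v : adj G u v -> ~~ adj G r u -> adj G r v -> neg G u v = th u (+) th v.
  move=> uv nru rv; rewrite /th (negPf nru) rv.
  have [->|nvq] := eqVneq v q; first by rewrite -addbA addbb addbF.
  have [->|nur] := eqVneq u r; first by rewrite addbb addFb.
  have qu : adj G q u.
    move: nru uv rq; rewrite !multi_adjE => nru /and3P[uW _ _] /and3P[rW qW].
    by move: nru; rewrite rW uW qW /= negbK => /eqP ->; rewrite eq_sym.
  have := square u v r q nur nvq uv; rewrite (adj_sym G v r) => /(_ rv rq qu).
  rewrite (neg_sym G v r) (neg_sym G q u).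
  by case: (neg G u v); case: (neg G r v); case: (neg G r q); case: (neg G u q).
exists th => u v uv.
have [ru|nru] := boolP (adj G r u); have [rv|nrv] := boolP (adj G r v).
- have := triangle r u v ru uv; rewrite (adj_sym G v r) => /(_ rv).
  rewrite /th ru rv (neg_sym G v r).
  by case: (neg G u v); case: (neg G r v); case: (neg G r u).
- by rewrite neg_sym half // 1?adj_sym // addbC.
- exact: half.
(* Two non-isolated vertices not adjacent to [r] both lie in its part, so they cannot be
   adjacent. *)
- move: nru nrv uv rq; rewrite !multi_adjE => nru nrv /and3P[uW vW nuv] /and3P[rW _ _].
  move: nru nrv nuv; rewrite rW uW vW /= !negbK => /eqP <- /eqP <-.
  by rewrite eqxx.
Qed.

End CompleteMultipartite.

(** * Sufficiency: the extremal graphs attain the bound *)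

Section Sufficiency.
Variables (R : realType) (n : nat) (G : sgraph n).

(** A potential makes the signed adjacency matrix a sign conjugate of the unsigned one, so an
    unsigned eigenvector [w] can be flipped. *)
Lemma potential_eigenvalue th (w : 'rV[R]_n) mu :
  (forall u v, adj G u v -> neg G u v = th u (+) th v) -> w != 0 ->
  (forall j, \sum_(i in [set i | adj G i j]) w 0 i = mu * w 0 j) ->
  eigenvalue (adjmx R G) mu.
Proof.
move=> thE w0 sumE; apply/eigenvalueP; exists (flip th w); last exact: flip_neq0.
apply/rowP => j; rewrite [LHS]mxE [RHS]mxE [flip th w 0 j]mxE mulrCA -sumE.
rewrite mulr_sumr [RHS]big_mkcond; apply: eq_bigr => i _; rewrite !mxE inE.
case: ifP => [ij|_]; last by rewrite mulr0.
by rewrite thE // signr_addb mulrCA !mulrA -expr2 sqrr_sign mul1r mulrC.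
Qed.

(** Positive edges are among all edges, and [(c - 1) / c] increases in [c <= k]. The right-hand side
    is summed by degrees. *)
Lemma local_bound_le G' th k : sgeq G' (switch G th) -> (2 <= k)%N ->
  (omega_b G <= k)%N ->
  local_bound R G G' <=
  Num.sqrt (\sum_j #|[set i | adj G i j]|%:R * ((k%:R - 1) / k%:R)).
Proof.
move=> sG k2 ok; rewrite local_boundE; apply: ler_wsqrtr.
have k2R : 2 <= k%:R :> R by rewrite ler_nat.
have kk : 0 <= (k%:R - 1) / k%:R :> R by rewrite divr_ge0; lra.
have -> : \sum_j #|[set i | adj G i j]|%:R * ((k%:R - 1) / k%:R)
  = \sum_(p : 'I_n * 'I_n) (if adj G p.1 p.2 then (k%:R - 1) / k%:R else 0 : R).
  rewrite -(pair_big xpredT xpredT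
     (fun i j => if adj G i j then (k%:R - 1) / k%:R else 0 : R)) /=.
  apply: eq_bigr => j _; rewrite -big_mkcond sumr_const -[RHS]mulr_natl.
  by congr (_%:R * _); apply: eq_card => i; rewrite inE adj_sym.
rewrite big_mkcond; apply: ler_sum => [[i j]] _ /=.
case: ifP => [pij|_]; last by case: ifP.
have aij : adj G i j by rewrite (switching_adjE sG); case/andP: pij.
rewrite aij; have := c_b_edge_ge2 aij; rewrite -(ler_nat R) => c2.
have := leq_trans (c_b_leq_omega_b G [set i; j]) ok; rewrite -(ler_nat R) => ck.
rewrite ler_pdivrMr; last by lra.
by rewrite mulrAC ler_pdivlMr; lra.
Qed.

(** A sandwich: [mu <= lambda1 <= local_bound <= mu]. *)
Lemma local_bound_attained mu k G' : switching_equivalent G G' ->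
  has_nonneg_lambda1_eigenvector (adjmx R G') ->
  (2 <= k)%N -> (omega_b G <= k)%N -> 0 <= mu -> eigenvalue (adjmx R G) mu ->
  \sum_j #|[set i | adj G i j]|%:R * ((k%:R - 1) / k%:R) = mu ^+ 2 ->
  lambda1 (adjmx R G) = local_bound R G G'.
Proof.
move=> [th sG] [x [x0 xA xge0]] k2 ok mu0 Amu sumE; apply/eqP; rewrite eq_le.
rewrite -{1}(lambda1_switching R sG) (lambda1_le_local_bound sG x0 xge0 xA) /=.
apply: le_trans (local_bound_le sG k2 ok) _; rewrite sumE sqrtr_sqr ger0_norm //.
by have [_] := lambda1_max Amu; apply.
Qed.

Section Potential.
Variables (P : {set {set 'I_n}}) (th : 'I_n -> bool).
Hypothesis GP : complete_multipartite_with G P.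
Hypothesis thE : forall u v, adj G u v -> neg G u v = th u (+) th v.

Lemma multi_nbrs_isolated j : j \notin cover P -> [set i | adj G i j] = set0.
Proof.
by move=> jW; apply/setP => i; rewrite !inE (multi_adjE GP) (negPf jW) andbF.
Qed.

Lemma multi_sum_degrees (c : R) :
  \sum_j #|[set i | adj G i j]|%:R * c =
  \sum_(B in P) #|B|%:R * (#|cover P|%:R - #|B|%:R) * c.
Proof.
rewrite (bigID (mem (cover P))) /= [X in _ + X]big1 ?addr0; last first.
  by move=> j jW; rewrite multi_nbrs_isolated // cards0 mul0r.
rewrite big_trivIset; last exact: multi_trivIset GP.
apply: eq_bigr => B BP; rewrite (eq_bigr (fun=> (#|cover P|%:R - #|B|%:R) * c)).
  by rewrite sumr_const -[LHS]mulr_natl mulrA.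
move=> j jB; rewrite (multi_nbrs GP BP jB); congr (_ * _).
rewrite cardsD (setIidPr (bigcup_sup _ BP)) natrB //.
exact/subset_leq_card/(bigcup_sup _ BP).
Qed.

Lemma regular_multi_eigenvalue s : (0 < s)%N -> (0 < #|P|)%N ->
  {in P, forall B : {set 'I_n}, #|B| = s} ->
  eigenvalue (adjmx R G) ((#|P|%:R - 1) * s%:R).
Proof.
move=> s0 P0 Ps.
have cW : #|cover P| = (#|P| * s)%N by apply: card_uniform_partition Ps (proj1 GP).
(* Every vertex of the cover has the same degree, so its indicator is an unsigned eigenvector. *)
pose w : 'rV[R]_n := \row_i (i \in cover P)%:R.
apply: (@potential_eigenvalue th w) => //.
  have /card_gt0P[i iW] : (0 < #|cover P|)%N by rewrite cW muln_gt0 P0.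
  apply/eqP => /rowP/(_ i); rewrite !mxE iW => /eqP; by rewrite oner_eq0.
move=> j; rewrite [w 0 j]mxE.
have [jW|jW] := boolP (j \in cover P); last first.
  by rewrite multi_nbrs_isolated // big_set0 mulr0.
have BP := multi_pblock_mem (P := P) jW; have jB : j \in pblock P j by rewrite mem_pblock.
rewrite (multi_nbrs GP BP jB) (eq_bigr (fun=> 1)); last first.
  by move=> i; rewrite !inE mxE => /andP[_ ->].
rewrite sumr_const cardsD (setIidPr (bigcup_sup _ BP)) cW Ps // natrB ?leq_pmull //.
by rewrite natrM /=; ring.
Qed.

End Potential.

Lemma bipartite_eigenvalue th (X Y : {set 'I_n}) :
  (forall u v, adj G u v -> neg G u v = th u (+) th v) ->
  X != Y -> complete_multipartite_with G [set X; Y] ->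
  eigenvalue (adjmx R G) (Num.sqrt #|X|%:R * Num.sqrt #|Y|%:R).
Proof.
move=> thE nXY GP.
have XP : X \in [set X; Y] by rewrite !inE eqxx.
have YP : Y \in [set X; Y] by rewrite !inE eqxx orbT.
have cE : cover [set X; Y] = X :|: Y by rewrite /cover bigcup_setU !big_set1.
have dXY : [disjoint X & Y] by have /trivIsetP := multi_trivIset GP; apply.
have YX i : i \in Y -> (i \in X) = false.
  by move=> iY; apply/negP => iX; move/pred0P: dXY => /(_ i) /=; rewrite iX iY.
(* The crossed weights balance the unequal degrees: a vertex of [X] sees [#|Y|] entries [sqrt #|X|],
   that is [mu * sqrt #|Y|]. *)
pose w : 'rV[R]_n := \row_i if i \in X then Num.sqrt #|Y|%:R else
   if i \in Y then Num.sqrt #|X|%:R else 0.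
have sqX : Num.sqrt #|X|%:R ^+ 2 = #|X|%:R :> R by rewrite sqr_sqrtr ?ler0n.
have sqY : Num.sqrt #|Y|%:R ^+ 2 = #|Y|%:R :> R by rewrite sqr_sqrtr ?ler0n.
apply: (@potential_eigenvalue th w) => //.
  have [i iX] := multi_part_nonempty GP XP; have [j jY] := multi_part_nonempty GP YP.
  apply/eqP => /rowP/(_ i); rewrite !mxE iX => /eqP; rewrite sqrtr_eq0 leNgt ltr0n.
  by apply/negP; rewrite negbK; apply/card_gt0P; exists j.
move=> j; rewrite [w 0 j]mxE; case: ifP => jX; last case: ifP => jY.
- rewrite (multi_nbrs GP XP jX) cE (eq_bigl (mem Y)); last first.
    by move=> i; rewrite !inE; case: (boolP (i \in Y)) => [/YX->//|]; case: (i \in X).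
  rewrite (eq_bigr (fun=> Num.sqrt #|X|%:R)) => [|i /= iY]; last by rewrite mxE YX // iY.
  by rewrite sumr_const -[LHS]mulr_natl -{1}sqY; ring.
- rewrite (multi_nbrs GP YP jY) cE (eq_bigl (mem X)); last first.
    by move=> i; rewrite !inE; case: (boolP (i \in Y)) => [/YX->//|_]; rewrite orbF.
  rewrite (eq_bigr (fun=> Num.sqrt #|Y|%:R)) => [|i /= iX]; last by rewrite mxE iX.
  by rewrite sumr_const -[LHS]mulr_natl -{1}sqX; ring.
- by rewrite (multi_nbrs_isolated GP) ?cE ?inE ?jX ?jY // big_set0 mulr0.
Qed.

Lemma structure_attains_bound G' : (2 <= omega_b G)%N -> balanced G ->
  (omega_b G = 2%N /\ complete_partite_plus_isolated 2 G) \/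
  ((3 <= omega_b G)%N /\ complete_regular_partite_plus_isolated (omega_b G) G) ->
  switching_equivalent G G' -> has_nonneg_lambda1_eigenvector (adjmx R G') ->
  lambda1 (adjmx R G) = local_bound R G G'.
Proof.
move=> om2 bG struct sG ev.
case: struct => [[om [P [cP GP]]]|[om3 [P [cP regP GP]]]].
  have [th thE] := balanced_multi_potential GP bG.
  move/eqP: cP => /cards2P[X [Y [nXY PE]]]; rewrite PE in GP.
  have mu := bipartite_eigenvalue thE nXY GP.
  apply: (local_bound_attained (k := 2%N) sG ev _ _ _ mu) => //; first by rewrite om.
    by rewrite mulr_ge0 ?sqrtr_ge0.
  (* The degrees sum to [2 * #|X| * #|Y|], and the factor for [k = 2] is one half. *)
  rewrite (multi_sum_degrees GP) big_setU1 ?inE //= big_set1.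
  rewrite exprMn !sqr_sqrtr ?ler0n //.
  have -> : cover [set X; Y] = X :|: Y by rewrite /cover bigcup_setU !big_set1.
  have /trivIsetP dXY := multi_trivIset GP.
  rewrite cardsU disjoint_setI0 ?cards0 ?subn0 ?natrD; first by field.
  by apply: dXY; rewrite ?inE ?eqxx ?orbT.
have [th thE] := balanced_multi_potential GP bG.
have P0 : (0 < #|P|)%N by rewrite cP (ltn_trans _ om2).
have /card_gt0P[B BP] := P0.
have s0 : (0 < #|B|)%N by apply/card_gt0P/(multi_part_nonempty GP BP).
have Ps : {in P, forall X : {set 'I_n}, #|X| = #|B|} by move=> X XP; apply: regP.
have mu := regular_multi_eigenvalue GP thE s0 P0 Ps.
apply: (local_bound_attained (k := omega_b G) sG ev _ _ _ mu) => //.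
  by rewrite mulr_ge0 // subr_ge0 ler1n.
rewrite (multi_sum_degrees GP) (eq_bigr (fun=> #|B|%:R *
  (#|cover P|%:R - #|B|%:R) * (((omega_b G)%:R - 1) / (omega_b G)%:R))); last first.
  by move=> X XP; rewrite Ps.
have -> : #|cover P| = (#|P| * #|B|)%N by apply: card_uniform_partition Ps (proj1 GP).
rewrite sumr_const -[LHS]mulr_natl cP natrM; field.
by rewrite pnatr_eq0 -lt0n (ltn_trans _ om2).
Qed.

End Sufficiency.

(** * Necessity: the structure forced by equality *)

Section Necessity.
Variables (R : realType) (n : nat) (G : sgraph n).
Hypothesis om2 : (2 <= omega_b G)%N.
Hypothesis eqG : forall G' : sgraph n,
  switching_equivalent G G' ->
  has_nonneg_lambda1_eigenvector (adjmx R G') ->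
  lambda1 (adjmx R G) = local_bound R G G'.

Section Fixed.
Variables (G' : sgraph n) (th : 'I_n -> bool) (x : 'rV[R]_n).
Hypothesis sG : sgeq G' (switch G th).
Hypotheses (x0 : x != 0) (xge0 : forall i, 0 <= x 0 i).
Hypothesis xA : x *m adjmx R G' = lambda1 (adjmx R G') *: x.

Lemma all_eq_bound : lambda1 (adjmx R G') = local_bound R G G'.
Proof. by rewrite (lambda1_switching R sG) -eqG //; [exists th | exists x]. Qed.

(* Switching at a vertex [i] with [x_i = 0] keeps [x] an eigenvector, so a
   negative edge at [i] may be assumed positive. *)
Lemma edge_supp i j : adj G' i j -> 0 < x 0 i.
Proof.
move=> aij; have [nij|pij] := boolP (neg G' i j); last first.
  have pij' : pos_adj G' i j by rewrite /pos_adj aij.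
  by have [] := eq_bound_pos_supp sG x0 xge0 xA all_eq_bound pij'.
rewrite lt_neqAle xge0 andbT; apply/negP => /eqP xi0.
have nji : (j == i) = false.
  by apply: contraTF aij => /eqP->; rewrite adj_irr.
pose th1 v := v == i; pose G1 := switch G' th1.
have s1 : sgeq G1 (switch G' th1) by [].
have flipx : flip th1 x = x.
  apply/rowP => l; rewrite mxE /th1; have [->|_] := eqVneq l i.
    by rewrite -xi0 mulr0.
  by rewrite expr0 mul1r.
have sG1 : sgeq G1 (switch G (fun v => th1 v (+) th v)).
  move=> u v; have [/= ea en] := sG u v; split=> //= /en nE.
  rewrite /switch_neg nE /switch_neg.
  by case: (th u); case: (th v); case: (neg G u v); case: (th1 u); case: (th1 v).
have x1A : x *m adjmx R G1 = lambda1 (adjmx R G1) *: x.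
  by rewrite (lambda1_switching R s1) -{1 2}flipx; apply: flip_eigen s1 xA.
(* Equality for [G1] is available because the hypothesis ranges over all admissible switchings. *)
have eq1 : lambda1 (adjmx R G1) = local_bound R G G1.
  rewrite (lambda1_switching R sG1) -eqG //; first by exists (fun v => th1 v (+) th v).
  by exists x.
have p1 : pos_adj G1 i j.
  by rewrite /pos_adj /= aij /switch_neg nij /th1 eqxx nji.
have [] := eq_bound_pos_supp sG1 x0 xge0 x1A eq1 p1.
by rewrite -xi0 ltxx.
Qed.

(** Equality makes [x_i * x_j] vanish on negative edges, yet both ends of any edge lie in the
    support. *)
Lemma all_edges_pos i j : adj G' i j -> pos_adj G' i j.
Proof.
move=> aij; rewrite /pos_adj aij; apply/negP => nij.
have := eq_bound_neg_supp sG x0 xge0 xA all_eq_bound aij nij.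
have aji : adj G' j i by rewrite adj_sym.
by apply/eqP; rewrite gt_eqF // mulr_gt0 // (edge_supp aij, edge_supp aji).
Qed.

Let posE i j : pos_adj G' i j = adj G i j.
Proof.
by rewrite (switching_adjE sG); apply/idP/idP => [/andP[]|/all_edges_pos].
Qed.

Let W : {set 'I_n} := [set i | 0 < x 0 i].
Let e : rel 'I_n := fun i j => ~~ adj G i j.
Let P := equivalence_partition e W.

Lemma nonadj_equivalence : {in W & &, equivalence_rel e}.
Proof.
have tr i j k : i \in W -> j \in W -> k \in W -> e i j -> e j k -> e i k.
  rewrite !inE; apply: (eq_bound_nonadj_trans sG x0 xge0 xA all_eq_bound).
    exact: all_edges_pos.
  exact: omega_b_ge2_edge.
move=> i j k iW jW kW; split; first by rewrite /e adj_irr.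
move=> eij; have eji : e j i by rewrite /e adj_sym.
by apply/idP/idP; apply: tr.
Qed.

Lemma supp_multipartite : complete_multipartite_with G P.
Proof.
have partP := equivalence_partitionP nonadj_equivalence.
have coverP := cover_partition partP; rewrite -/P in partP coverP.
have [_ tP _] := and3P partP.
split; first by rewrite coverP.
move=> u v; rewrite coverP.
have [uW|uW] := boolP (u \in W); last first.
  apply/negP => auv; case/negP: uW; rewrite inE.
  by apply: (@edge_supp u v); rewrite -(switching_adjE sG).
have [vW|vW] := boolP (v \in W); last first.
  apply/negP => auv; case/negP: vW; rewrite inE.
  by apply: (@edge_supp v u); rewrite -(switching_adjE sG) adj_sym.
rewrite /= eq_pblock ?coverP // (pblock_equivalence_partition nonadj_equivalence) //.
by rewrite negbK.
Qed.

Lemma necessary_structure : balanced G /\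
  ((omega_b G = 2%N /\ complete_partite_plus_isolated 2 G) \/
   ((3 <= omega_b G)%N /\ complete_regular_partite_plus_isolated (omega_b G) G)).
Proof.
have GP := supp_multipartite.
have coverP : cover P = W := cover_partition (equivalence_partitionP nonadj_equivalence).
(* The transversal clique through an edge has only positive edges in [G'], so it is balanced in
   [G]. *)
have cbP u v : adj G u v -> (#|P| <= c_b G [set u; v])%N.
  move=> uv; have [K [uK vK <- clK]] := multi_clique_through GP uv.
  apply: leq_c_b; last by apply/subsetP => l; rewrite !inE => /orP[]/eqP->.
  by apply: (pos_clique_balanced sG) => a b aK bK nab; rewrite posE clK.
have omP : omega_b G = #|P|.
  apply/eqP; rewrite eqn_leq; apply/andP; split.
    have [S [clS _] SE] := omega_b_attained G.
    by rewrite -SE; apply: (multi_clique_le_parts GP) => //; rewrite SE.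
  have [u [v uv]] := omega_b_ge2_edge om2.
  exact: leq_trans (cbP u v uv) (c_b_leq_omega_b _ _).
split.
  move=> c cyc; apply: (balanced_cycle_potential (th := th) cyc) => u v _ _ uv.
  by apply: (pos_adj_potential sG); rewrite posE.
have [om3|om3] := leqP 3 (omega_b G); last first.
  have om : omega_b G = 2%N by apply/eqP; rewrite eqn_leq om2 -ltnS om3.
  by left; split=> //; exists P; rewrite -omP.
right; split=> //; exists P; split=> //.
have cbE u v : adj G u v -> c_b G [set u; v] = omega_b G.
  by move=> uv; apply/eqP; rewrite eqn_leq c_b_leq_omega_b omP cbP.
(* With all [c_b] equal, [x_i x_l] is the same for every edge; a common neighbour [l], available
   from three parts on, gives [x_i = x_j]. *)
have xconst i j : i \in W -> j \in W -> x 0 i = x 0 j.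
  move=> iW jW; rewrite -coverP in iW jW.
  have [|l il jl] := multi_common_nbr GP iW jW; first by rewrite -omP.
  have xl : x 0 l != 0.
    by rewrite gt_eqF // (@edge_supp l i) // -(switching_adjE sG) adj_sym.
  apply: (mulIf xl).
  have pil : pos_adj G' i l by rewrite posE.
  have pjl : pos_adj G' j l by rewrite posE.
  rewrite (eq_bound_product sG x0 xge0 xA all_eq_bound pil).
  by rewrite (eq_bound_product sG x0 xge0 xA all_eq_bound pjl) !cbE.
(* Since [x] is constant on [W], the eigenvector equation at [i] equates the eigenvalue with the
   degree of [i], which determines the size of its part. *)
have degE B i : B \in P -> i \in B ->
    lambda1 (adjmx R G') = #|W|%:R - #|B|%:R.
  move=> BP iB; have iW := multi_part_cover BP iB; rewrite coverP in iW.
  have xi : x 0 i != 0 by move: iW; rewrite inE => /gt_eqF->.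
  apply: (mulIf xi); have /rowP/(_ i) := xA.
  rewrite [LHS]mxE [RHS]mxE => <-.
  have BW : B \subset W by rewrite -coverP; apply: bigcup_sup BP.
  rewrite -natrB ?subset_leq_card // -{1}(setIidPr BW) -cardsD -coverP.
  rewrite -(multi_nbrs GP BP iB) mulr_natl -sumr_const big_mkcond.
  rewrite [RHS]big_mkcond; apply: eq_bigr => l _ /=; rewrite !mxE inE.
  rewrite -(switching_adjE sG); case: ifP => ali; last by rewrite mulr0.
  have := posE l i; rewrite ali => /andP[_ /negPf->]; rewrite expr0 mulr1.
  apply: xconst => //; rewrite inE.
  by apply: (@edge_supp l i); rewrite -(switching_adjE sG).
move=> X Y XP YP.
have [i iX] := multi_part_nonempty GP XP; have [j jY] := multi_part_nonempty GP YP.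
apply/eqP; rewrite -(eqr_nat R); apply/eqP.
by have := degE X i XP iX; rewrite (degE Y j YP jY); lra.
Qed.

End Fixed.
End Necessity.

Theorem theorem1p1 (R : realType) (n : nat) (G : sgraph n)
    (homega : (2 <= omega_b G)%N) :
  (forall G' : sgraph n,
      switching_equivalent G G' ->
      has_nonneg_lambda1_eigenvector (adjmx R G') ->
      lambda1 (adjmx R G) <= local_bound R G G')
  /\
  ((forall G' : sgraph n,
      switching_equivalent G G' ->
      has_nonneg_lambda1_eigenvector (adjmx R G') ->
      lambda1 (adjmx R G) = local_bound R G G')
   <->
   (balanced G /\
    ((omega_b G = 2%N /\ complete_partite_plus_isolated 2 G) \/
     ((3 <= omega_b G)%N /\
      complete_regular_partite_plus_isolated (omega_b G) G)))).
Proof.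
split=> [G' [th sG] [x [x0 xA xge0]]|].
  by rewrite -(lambda1_switching R sG) (lambda1_le_local_bound sG x0 xge0 xA).
split=> [eqG|[bG struct] G' sG ev]; last exact: structure_attains_bound.
(* The vertex [u] shows that [n] is positive, as the existence of a non-negative switching
   requires. *)
have [u _] := omega_b_ge2_edge homega.
have [G' [th sG] [x [x0 xA xge0]]] :=
  exists_nonneg_switching R G (leq_ltn_trans (leq0n u) (ltn_ord u)).
exact: (necessary_structure homega eqG sG x0 xge0 xA).
Qed.
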